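(* Let $G$ be a finite group, $\omega$ a normalized $3$-cocycle on $G$ with values in $\Bbbk^\times$, $L$ a subgroup of $G$ such that the class of $\omega|_{L^{\times 3}}$ is trivial, and $\psi\in C^2(L,\Bbbk^\times)$ a normalized $2$-cochain with $d\psi=\omega|_{L^{\times 3}}$. The twisted group algebra $A(L,\psi)$ in $\mathsf{Vec}_G^\omega$, with the structural morphisms $$m(\delta_g\otimes\delta_{g'})=\psi(g,g')\,\delta_{gg'},\quad u(\delta_e)=\delta_e,\quad \Delta(\delta_g)=|L|^{-1}\sum_{h\in L}\psi^{-1}(gh,h^{-1})\,[\delta_{gh}\otimes\delta_{h^{-1}}],\quad \varepsilon(\delta_g)=\delta_{g,e}\,|L|\,\delta_e$$ ($g,g'\in L$), is: (a) connected; (b) indecomposable; (c) special; (d) separable.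
   Context: $\Bbbk$ is an algebraically closed field of characteristic $0$. $\mathsf{Vec}_G^\omega$: the fusion category of finite-dimensional $G$-graded $\Bbbk$-vector spaces with grading-preserving linear maps. Its simple objects are $\delta_g$ ($g\in G$), one-dimensional in degree $g$; $\delta_g$ also denotes a fixed basis vector. Associativity $\alpha_{\delta_g,\delta_{g'},\delta_{g''}}=\omega^{-1}(g,g',g'')\,\mathrm{id}:(\delta_g\otimes\delta_{g'})\otimes\delta_{g''}\to\delta_g\otimes(\delta_{g'}\otimes\delta_{g''})$; unit $\mathbf 1=\delta_e$, with $l_{\delta_g}=\omega^{-1}(e,e,g)\,\mathrm{id}$, $r_{\delta_g}=\omega(g,e,e)\,\mathrm{id}$. Cocycle condition: $\omega(g_1g_2,g_3,g_4)\omega(g_1,g_2,g_3g_4)=\omega(g_1,g_2,g_3)\omega(g_1,g_2g_3,g_4)\omega(g_2,g_3,g_4)$. The condition $d\psi=\omega|_{L^{\times3}}$ means $\psi(f_1,f_2f_3)\psi(f_2,f_3)=\omega(f_1,f_2,f_3)\psi(f_1f_2,f_3)\psi(f_1,f_2)$ for $f_i\in L$. The scalar $\delta_{g,e}$ is the Kronecker delta. The twisted group algebra is $A(L,\psi)=\bigoplus_{g\in L}\delta_g$ as an object; the given morphisms make it a Frobenius algebra (an associative unital algebra and coassociative counital coalgebra with $(m\otimes\mathrm{id})\alpha^{-1}(\mathrm{id}\otimes\Delta)=\Delta m=(\mathrm{id}\otimes m)\alpha(\Delta\otimes\mathrm{id})$). Properties of an algebra $(A,m,u)$ in a fusion category: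 connected: $\dim_\Bbbk\mathrm{Hom}(\mathbf 1,A)=1$; indecomposable: not isomorphic to a direct sum of nontrivial algebras; separable: there is $\Delta':A\to A\otimes A$ with $m\Delta'=\mathrm{id}_A$ and $(\mathrm{id}\otimes m)\alpha_{A,A,A}(\Delta'\otimes\mathrm{id})=\Delta'm=(m\otimes\mathrm{id})\alpha^{-1}_{A,A,A}(\mathrm{id}\otimes\Delta')$. A Frobenius algebra is special if $m\Delta=\mathrm{id}_A$ and $\varepsilon u=\varphi\,\mathrm{id}_{\mathbf 1}$ for some nonzero $\varphi\in\Bbbk$. *)

(* Defs.v *)
From HB Require Import structures.
From mathcomp Require Import all_boot all_order all_fingroup all_algebra.

Set Implicit Arguments.
Unset Strict Implicit.
Unset Printing Implicit Defensive.

Import GRing.Theory VectorInternalTheory.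
Local Open Scope ring_scope.

Section TensorProduct.

Variable k : fieldType.
Implicit Types U V W : vectType k.

Lemma linfunE V W (f : V -> W) : linear f -> linfun f =1 f.
Proof.
by move=> hf v; pose fL : {linear V -> W} := HB.pack f (GRing.isLinear.Build _ _ _ _ f hf);
  rewrite -[f]/(fL : V -> W) lfunE.
Qed.

(* Coordinate model of the tensor product of V and W: the pure tensor of v and
   w is the matrix of the products of their coordinates. Its universal property
   is tens_bilinear, tliftE and tens_ext. *)
Definition tensor V W : vectType k := 'M[k]_(dim V, dim W).

Definition tens V W (v : V) (w : W) : tensor V W := (v2r v)^T *m v2r w.

Definition bilinear_fun V W U (b : V -> W -> U) : Prop :=
  (forall w, linear (b^~ w)) /\ (forall v, linear (b v)).

(* The linear map v (x) w |-> b v w, for a bilinear b; see tliftE. *)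
Definition tlift V W U (b : V -> W -> U) : 'Hom(tensor V W, U) :=
  linfun (fun M : 'M[k]_(dim V, dim W) =>
    \sum_i \sum_j M i j *: b (r2v (delta_mx 0 i)) (r2v (delta_mx 0 j))).

Lemma tens_bilinear V W : bilinear_fun (@tens V W).
Proof.
split=> [w a u v|v a u w]; rewrite /tens linearP /=.
  by rewrite linearP mulmxDl scalemxAl.
by rewrite mulmxDr scalemxAr.
Qed.

Lemma r2v_sum V (v : V) : v = \sum_i v2r v 0 i *: r2v (delta_mx 0 i).
Proof.
rewrite -[LHS]v2rK {1}[v2r v]row_sum_delta linear_sum.
by apply: eq_bigr => i _; rewrite linearZ.
Qed.

Lemma linear_sumZ V U (f : V -> U) (I : finType) (c : I -> k) (v : I -> V) :
  linear f -> f (\sum_i c i *: v i) = \sum_i c i *: f (v i).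
Proof.
move=> hf; rewrite -(linfunE hf) linear_sum; apply: eq_bigr => i _.
by rewrite linearZ /= linfunE.
Qed.

Lemma tliftE V W U (b : V -> W -> U) v w :
  bilinear_fun b -> tlift b (tens v w) = b v w.
Proof.
case=> bl br; rewrite /tlift linfunE; last first.
  move=> a M N; rewrite scaler_sumr -big_split; apply: eq_bigr => i _ /=.
  rewrite scaler_sumr -big_split; apply: eq_bigr => j _ /=.
  by rewrite !mxE scalerDl scalerA.
rewrite [in RHS](r2v_sum v) (linear_sumZ _ _ (bl w)).
apply: eq_bigr => i _; rewrite [in RHS](r2v_sum w) (linear_sumZ _ _ (br _)).
rewrite scaler_sumr; apply: eq_bigr => j _.
by rewrite /tens mxE big_ord1 mxE scalerA.
Qed.

Lemma tens_span V W (x : tensor V W) :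
  x = \sum_i \sum_j x i j *: tens (r2v (delta_mx 0 i) : V) (r2v (delta_mx 0 j) : W).
Proof.
rewrite [LHS]matrix_sum_delta; apply: eq_bigr => i _; apply: eq_bigr => j _.
by rewrite /tens !r2vK trmx_delta mul_delta_mx.
Qed.

Lemma tens_ext V W U (f g : 'Hom(tensor V W, U)) :
  (forall v w, f (tens v w) = g (tens v w)) -> f = g.
Proof.
move=> fg; apply/lfunP=> x; rewrite (tens_span x) !linear_sum.
apply: eq_bigr => i _; rewrite !linear_sum; apply: eq_bigr => j _.
by rewrite !linearZ /= fg.
Qed.

Lemma tensDl V W (v v' : V) (w : W) : tens (v + v') w = tens v w + tens v' w.
Proof. by have := (tens_bilinear V W).1 w 1 v v'; rewrite !scale1r. Qed.
Lemma tensDr V W (v : V) (w w' : W) : tens v (w + w') = tens v w + tens v w'.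
Proof. by have := (tens_bilinear V W).2 v 1 w w'; rewrite !scale1r. Qed.
Lemma tens0l V W (w : W) : tens (0 : V) w = 0.
Proof. by rewrite /tens linear0 linear0 mul0mx. Qed.
Lemma tens0r V W (v : V) : tens v (0 : W) = 0.
Proof. by rewrite /tens linear0 mulmx0. Qed.
Lemma tensZl V W a (v : V) (w : W) : tens (a *: v) w = a *: tens v w.
Proof. by have := (tens_bilinear V W).1 w a v 0; rewrite tens0l !addr0. Qed.
Lemma tensZr V W a (v : V) (w : W) : tens v (a *: w) = a *: tens v w.
Proof. by have := (tens_bilinear V W).2 v a w 0; rewrite tens0r !addr0. Qed.
Lemma tens_suml V W (I : finType) (P : pred I) (F : I -> V) (w : W) :
  tens (\sum_(i | P i) F i) w = \sum_(i | P i) tens (F i) w.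
Proof.
exact: (big_morph (fun v => tens v w) (fun u v => tensDl u v w) (tens0l V w)).
Qed.
Lemma tens_sumr V W (I : finType) (P : pred I) (v : V) (F : I -> W) :
  tens v (\sum_(i | P i) F i) = \sum_(i | P i) tens v (F i).
Proof. exact: (big_morph (tens v) (tensDr v) (tens0r W v)). Qed.

Definition tens_hom V V' W W' (f : 'Hom(V, V')) (g : 'Hom(W, W')) :
    'Hom(tensor V W, tensor V' W') :=
  tlift (fun v w => tens (f v) (g w)).

Lemma tens_homE V V' W W' (f : 'Hom(V, V')) (g : 'Hom(W, W')) v w :
  tens_hom f g (tens v w) = tens (f v) (g w).
Proof.
rewrite /tens_hom tliftE //; split=> [u a x y|u a x y]; rewrite linearP.
  by rewrite tensDl tensZl.
by rewrite tensDr tensZr.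
Qed.

End TensorProduct.

Section GradedVectorSpaces.

Variables (k : fieldType) (gT : finGroupType).

(* Finite-dimensional G-graded vector spaces, G being the group of all
   elements of gT: gr V g is the homogeneous component of degree g. *)
Definition is_grading (X : vectType k) (Y : gT -> {vspace X}) : Prop :=
  fullv = (\sum_g Y g)%VS /\ directv (\sum_g Y g).

Record gvect := Gvect {
  gsort :> vectType k;
  gr : gT -> {vspace gsort};
  gr_grading : is_grading gr }.

Arguments gr : clear implicits.
Implicit Types U V W : gvect.

Lemma gr_full V : fullv = (\sum_g gr V g)%VS.
Proof. by case: (gr_grading V). Qed.

Lemma gr_direct V : directv (\sum_g gr V g).
Proof. by case: (gr_grading V). Qed.

(* The projection of V onto its component of degree g. *)
Definition gcomp V (g : gT) : 'End(V) := sumv_pi_for (gr_full V) g.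

Lemma gcomp_in V g (v : V) : gcomp V g v \in gr V g.
Proof. exact: memv_sum_pi. Qed.

Lemma gcomp_sum V (v : V) : \sum_g gcomp V g v = v.
Proof. by apply: sumv_pi_sum; rewrite memvf. Qed.

Lemma gcomp_id V g h (v : V) :
  v \in gr V g -> gcomp V h v = if h == g then v else 0.
Proof.
move=> vg; have /directv_sum_unique/(_ (fun h => gcomp V h v))/(_ (fun h => if h == g then v else 0)) := gr_direct V.
rewrite gcomp_sum -big_mkcond big_pred1_eq eqxx => /(_ _ _)/esym/forall_inP H.
by apply/eqP/H=> // {}h _; [exact: gcomp_in | case: eqP => [->|]; rewrite ?mem0v].
Qed.

Lemma gr_ext V (U : vectType k) (f f' : 'Hom(V, U)) :
  (forall g v, v \in gr V g -> f v = f' v) -> f = f'.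
Proof.
move=> ff'; apply/lfunP=> v; rewrite -(gcomp_sum v) !linear_sum.
by apply: eq_bigr => g _; apply: (ff' g); apply: gcomp_in.
Qed.

(* The space of morphisms V -> W, i.e. of grading-preserving linear maps,
   encoded as the f that commute with the projections; see ghomP. *)
Definition ghom V W : {vspace 'Hom(V, W)} :=
  (\bigcap_g lker (linfun (fun f : 'Hom(V, W) =>
    ((f \o gcomp V g) - (gcomp W g \o f))%VF)))%VS.

Lemma ghomP V W (f : 'Hom(V, W)) :
  reflect (forall g v, v \in gr V g -> f v \in gr W g) (f \in ghom V W).
Proof.
have lin g : linear (fun f : 'Hom(V, W) => ((f \o gcomp V g) - (gcomp W g \o f))%VF).
  move=> a f1 f2; apply/lfunP=> v; rewrite !lfun_simp linearP /=.
  by rewrite scalerBr opprD addrACA.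
rewrite memvE; apply: (iffP subv_bigcapP) => [fP g v vg | fP g _].
  have := fP g isT; rewrite -memvE memv_ker linfunE // => /eqP/lfunP/(_ v).
  rewrite !lfun_simp (gcomp_id _ vg) eqxx => /eqP.
  by rewrite subr_eq0 => /eqP->; apply: gcomp_in.
rewrite -memvE memv_ker linfunE // subr_eq0; apply/eqP/(@gr_ext V) => h v vh.
rewrite !lfun_simp (gcomp_id _ vh) (gcomp_id _ (fP _ _ vh)).
by case: eqP; rewrite ?linear0.
Qed.

Lemma ghom_id V : \1%VF \in ghom V V.
Proof. by apply/ghomP=> g v; rewrite id_lfunE. Qed.

Lemma ghom_comp U V W (f : 'Hom(V, W)) (f' : 'Hom(U, V)) :
  f \in ghom V W -> f' \in ghom U V -> (f \o f')%VF \in ghom U W.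
Proof. by move=> /ghomP hf /ghomP hf'; apply/ghomP=> g v /hf'/hf; rewrite comp_lfunE. Qed.

Lemma is_grading_of (X : vectType k) (Y : gT -> {vspace X}) (p : gT -> 'End(X)) :
    (forall x, \sum_g p g x = x) -> (forall g x, p g x \in Y g) ->
    (forall g h x, x \in Y g -> p h x = if h == g then x else 0) ->
  is_grading Y.
Proof.
move=> psum pY pid; split.
  apply/esym/eqP; rewrite eqEsubv subvf; apply/subvP=> x _.
  by rewrite -(psum x); apply: memv_sumr.
apply/directv_sum_independent => us Yus us0 g _.
have /(congr1 (p g)) := us0; rewrite linear0 linear_sum (bigD1 g) //=.
rewrite big1 => [|h /negPf hg].
  by rewrite addr0 (pid g) ?eqxx // Yus.
by rewrite (pid h) ?Yus // eq_sym hg.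
Qed.

(* The simple object delta_g: the field k in degree g. *)
Definition delta_gr (g h : gT) : {vspace k^o} := if h == g then fullv else 0%VS.

Let delta_pr (g h : gT) : 'End(k^o) := if h == g then \1%VF else 0.

Fact delta_grading g : is_grading (delta_gr g).
Proof.
apply: (@is_grading_of _ _ (delta_pr g)) => [x|h x|a b x]; rewrite /delta_gr /delta_pr.
- rewrite (bigD1 g) //= eqxx id_lfunE big1 ?addr0 // => h /negPf->.
  by rewrite zero_lfunE.
- by case: eqP; rewrite ?memvf // zero_lfunE mem0v.
have [->|ag] := eqVneq a g; first by case: eqP; rewrite lfunE.
by rewrite memv0 => /eqP->; rewrite linear0 if_same.
Qed.

Definition gdelta g : gvect := Gvect (delta_grading g).

Definition gone : gvect := gdelta 1%g.

(* The component of degree g of V (x) W is spanned by the v (x) w with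
   v of degree h and w of degree h^-1 g, for h in G. *)
Definition tens_gr V W (g : gT) : {vspace tensor V W} :=
  (\sum_h <<[seq tens v w | v <- vbasis (gr V h), w <- vbasis (gr W (h^-1 * g)%g)]>>)%VS.

Lemma tens_gr_in V W a b (v : V) (w : W) :
  v \in gr V a -> w \in gr W b -> tens v w \in tens_gr V W (a * b)%g.
Proof.
move=> va wb; rewrite memvE (sumv_sup a) //= mulKg.
rewrite (coord_vbasis va) (coord_vbasis wb) tens_suml -memvE.
apply: memv_suml => i _; rewrite tens_sumr; apply: memv_suml => j _.
rewrite tensZl tensZr !memvZ // memv_span //; apply/allpairsP.
exists ((vbasis (gr V a))`_i, (vbasis (gr W b))`_j) => /=.
by rewrite !mem_nth ?size_tuple.
Qed.

Lemma tens_gr_sub V W g (S : {vspace tensor V W}) :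
  (forall a b v w, v \in gr V a -> w \in gr W b -> (a * b)%g = g -> tens v w \in S) ->
  (tens_gr V W g <= S)%VS.
Proof.
move=> H; apply/subv_sumP=> a _; apply/span_subvP=> _ /allpairsP[[v w] /= [va wb ->]].
by apply: H (vbasis_mem va) (vbasis_mem wb) _; rewrite mulKVg.
Qed.

Let tens_pr V W g : 'End(tensor V W) :=
  \sum_h tens_hom (gcomp V h) (gcomp W (h^-1 * g)%g).

Fact tens_grading V W : is_grading (tens_gr V W).
Proof.
apply: (@is_grading_of _ _ (tens_pr V W)) => [x|g x|g h x].
- rewrite -sum_lfunE (_ : \sum_g _ = \1%VF) ?id_lfunE //.
  apply: tens_ext => v w; rewrite id_lfunE sum_lfunE.
  under eq_bigr => g _.
    rewrite /tens_pr sum_lfunE; under eq_bigr => h _ do rewrite tens_homE.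
    over.
  rewrite exchange_big /= -[in RHS](gcomp_sum v) tens_suml.
  apply: eq_bigr => h _; rewrite -tens_sumr; congr tens.
  rewrite (reindex_inj (mulgI h)) /= -[RHS]gcomp_sum.
  by apply: eq_bigr => g _; rewrite mulKg.
- have : x \in (fullv : {vspace tensor V W}) by rewrite memvf.
suff /subvP H : (fullv <= tens_pr V W g @^-1: tens_gr V W g)%VS by move/H; rewrite memv_preim.
apply/subvP => {}x _; rewrite (tens_span x); apply: memv_suml => i _; apply: memv_suml => j _.
apply: memvZ; rewrite -memv_preim /tens_pr sum_lfunE; apply: memv_suml => h _.
rewrite tens_homE; rewrite -{2}(mulKVg h g); apply: tens_gr_in; exact: gcomp_in.
move: x.
suff H : (tens_gr V W g <= lker (tens_pr V W h - (if h == g then \1%VF else 0))%R)%VS.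
  move=> x /(subvP H); rewrite memv_ker !lfun_simp subr_eq0 => /eqP->.
  by case: eqP; rewrite lfunE.
apply: tens_gr_sub => a b v w va wb abg; rewrite memv_ker !lfun_simp subr_eq0; apply/eqP.
rewrite /tens_pr (bigD1 a) //= big1 => [|c /negPf ca]; last first.
  by rewrite tens_homE (gcomp_id _ va) ca tens0l.
rewrite addr0 tens_homE (gcomp_id _ va) eqxx (gcomp_id _ wb).
rewrite (can2_eq (mulKVg a) (mulKg a)) abg.
by case: eqP; rewrite lfunE // tens0r.
Qed.

Definition gtens V W : gvect := Gvect (tens_grading V W).

End GradedVectorSpaces.

Notation "V ⊗ W" := (gtens V W) (at level 40, left associativity).

Section MonoidalStructure.

Variables (k : fieldType) (gT : finGroupType).
Implicit Types U V W : gvect k gT.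

Lemma gr_tens_in V W a b (v : V) (w : W) :
  v \in gr V a -> w \in gr W b -> (tens v w : V ⊗ W) \in gr (V ⊗ W) (a * b)%g.
Proof. exact: tens_gr_in. Qed.

Lemma gtens_ext V W (U : vectType k) (f f' : 'Hom(V ⊗ W, U)) :
  (forall a b v w, v \in gr V a -> w \in gr W b -> f (tens v w) = f' (tens v w)) ->
  f = f'.
Proof.
move=> ff'; apply: tens_ext => v w.
rewrite -(gcomp_sum v) -(gcomp_sum w) tens_suml !linear_sum; apply: eq_bigr => a _.
rewrite tens_sumr !linear_sum; apply: eq_bigr => b _.
by apply: ff'; apply: gcomp_in.
Qed.

Lemma gtens_ext3 V W U (T : vectType k) (f f' : 'Hom((V ⊗ W) ⊗ U, T)) :
  (forall a b c v w u, v \in gr V a -> w \in gr W b -> u \in gr U c ->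
     f (tens (tens v w : V ⊗ W) u) = f' (tens (tens v w : V ⊗ W) u)) ->
  f = f'.
Proof.
move=> ff'; apply: tens_ext => x u.
rewrite (tens_span x) tens_suml !linear_sum; apply: eq_bigr => i _.
rewrite tens_suml !linear_sum; apply: eq_bigr => j _.
rewrite tensZl !linearZ /=; congr (_ *: _).
rewrite -(gcomp_sum (r2v _ : V)) -(gcomp_sum (r2v _ : W)) -(gcomp_sum u).
rewrite [tens _ (\sum_g gcomp W g _)]tens_suml tens_suml !linear_sum; apply: eq_bigr => a _.
rewrite [tens _ (\sum_g gcomp W g _)]tens_sumr tens_suml !linear_sum; apply: eq_bigr => b _.
rewrite tens_sumr !linear_sum; apply: eq_bigr => c _.
by apply: ff'; apply: gcomp_in.
Qed.

Lemma gtens_ext3' V W U (T : vectType k) (f f' : 'Hom(V ⊗ (W ⊗ U), T)) :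
  (forall a b c v w u, v \in gr V a -> w \in gr W b -> u \in gr U c ->
     f (tens v (tens w u : W ⊗ U)) = f' (tens v (tens w u : W ⊗ U))) ->
  f = f'.
Proof.
move=> ff'; apply: tens_ext => v x.
rewrite (tens_span x) tens_sumr !linear_sum; apply: eq_bigr => i _.
rewrite tens_sumr !linear_sum; apply: eq_bigr => j _.
rewrite tensZr !linearZ /=; congr (_ *: _).
rewrite -(gcomp_sum (r2v _ : W)) -(gcomp_sum (r2v _ : U)) -(gcomp_sum v).
rewrite tens_suml !linear_sum; apply: eq_bigr => a _.
rewrite [tens _ (\sum_g gcomp U g _)]tens_suml tens_sumr !linear_sum; apply: eq_bigr => b _.
rewrite [tens _ (\sum_g gcomp U g _)]tens_sumr tens_sumr !linear_sum; apply: eq_bigr => c _.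
by apply: ff'; apply: gcomp_in.
Qed.

Lemma ghom_tens_in V W U (f : 'Hom(V ⊗ W, U)) :
  (forall a b v w, v \in gr V a -> w \in gr W b -> f (tens v w) \in gr U (a * b)%g) ->
  f \in ghom (V ⊗ W) U.
Proof.
move=> H; apply/ghomP => g x.
suff /subvP S : (gr (V ⊗ W) g <= f @^-1: gr U g)%VS by move/S; rewrite memv_preim.
apply: tens_gr_sub => a b v w va wb <-; rewrite -memv_preim; exact: H.
Qed.

Lemma ghom_tens V V' W W' (f : 'Hom(V, V')) (f' : 'Hom(W, W')) :
  f \in ghom V V' -> f' \in ghom W W' ->
  (tens_hom f f' : 'Hom(V ⊗ W, V' ⊗ W')) \in ghom (V ⊗ W) (V' ⊗ W').
Proof.
move=> /ghomP hf /ghomP hf'; apply: ghom_tens_in => a b v w va wb.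
by rewrite tens_homE; apply: gr_tens_in; [apply: hf | apply: hf'].
Qed.

Section VectorSpaceLevel.
Implicit Types (X Y Z : vectType k).

(* The usual, untwisted isomorphisms (x (x) y) (x) z |-> x (x) (y (x) z),
   its inverse, c (x) x |-> c x and x (x) c |-> c x. *)
Definition vassoc X Y Z : 'Hom(tensor (tensor X Y) Z, tensor X (tensor Y Z)) :=
  tlift (fun t z => tlift (fun x y => tens x (tens y z)) t).
Definition vassocV X Y Z : 'Hom(tensor X (tensor Y Z), tensor (tensor X Y) Z) :=
  tlift (fun x t => tlift (fun y z => tens (tens x y) z) t).
Definition vlunit X : 'Hom(tensor k^o X, X) := tlift (fun (c : k^o) x => c *: x).
Definition vrunit X : 'Hom(tensor X k^o, X) := tlift (fun x (c : k^o) => c *: x).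

Lemma tlift_linear X Y Z (T : vectType k) (b : T -> X -> Y -> Z) (t : tensor X Y) :
  (forall x y, linear (fun u : T => b u x y)) -> linear (fun u : T => tlift (b u) t).
Proof.
move=> hb a u u'; have tE u0 : tlift (b u0) t = \sum_i \sum_j t i j *: b u0 (r2v (delta_mx 0 i)) (r2v (delta_mx 0 j)).
  rewrite linfunE // => c M N; rewrite scaler_sumr -big_split; apply: eq_bigr => i _ /=.
  rewrite scaler_sumr -big_split; apply: eq_bigr => j _ /=.
  by rewrite !mxE scalerDl scalerA.
rewrite !tE scaler_sumr -big_split; apply: eq_bigr => i _ /=.
rewrite scaler_sumr -big_split; apply: eq_bigr => j _ /=.
by rewrite hb scalerDr !scalerA mulrC.
Qed.

Lemma vassocE X Y Z (x : X) (y : Y) (z : Z) :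
  vassoc X Y Z (tens (tens x y) z) = tens x (tens y z).
Proof.
rewrite tliftE; last first.
  split=> [w|t]; first exact: linearP.
  by apply: tlift_linear => {}x {}y a u v; rewrite tensDr tensZr tensDr tensZr.
by rewrite tliftE //; split=> [w|w] a u v; rewrite ?tensDl ?tensZl ?tensDr ?tensZr.
Qed.

Lemma vassocVE X Y Z (x : X) (y : Y) (z : Z) :
  vassocV X Y Z (tens x (tens y z)) = tens (tens x y) z.
Proof.
rewrite tliftE; last first.
  split=> [t|w]; last exact: linearP.
  by apply: tlift_linear => {}y {}z a u v; rewrite tensDl tensZl tensDl tensZl.
rewrite tliftE //; split=> [w|w] a u v; first by rewrite tensDr tensZr tensDl tensZl.
by rewrite tensDr tensZr.
Qed.

Lemma vlunitE X (c : k^o) (x : X) : vlunit X (tens c x) = c *: x.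
Proof.
rewrite tliftE //; split=> [w|w] a u v; first by rewrite scalerDl scalerA.
by rewrite scalerDr !scalerA mulrC.
Qed.

Lemma vrunitE X (c : k^o) (x : X) : vrunit X (tens x c) = c *: x.
Proof.
rewrite tliftE //; split=> [w|w] a u v; last by rewrite scalerDl scalerA.
by rewrite scalerDr !scalerA mulrC.
Qed.

End VectorSpaceLevel.

Variable omega : gT -> gT -> gT -> k.

(* The structural isomorphisms of Vec_G^omega: on homogeneous vectors they
   multiply the untwisted ones by the given scalars; see assocE, assocVE,
   lunitE and runitE. *)
Definition assoc V W U : 'Hom((V ⊗ W) ⊗ U, V ⊗ (W ⊗ U)) :=
  \sum_a \sum_b \sum_c (omega a b c)^-1 *:
    (vassoc V W U \o tens_hom (tens_hom (gcomp V a) (gcomp W b)) (gcomp U c))%VF.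

Definition assocV V W U : 'Hom(V ⊗ (W ⊗ U), (V ⊗ W) ⊗ U) :=
  \sum_a \sum_b \sum_c omega a b c *:
    (vassocV V W U \o tens_hom (gcomp V a) (tens_hom (gcomp W b) (gcomp U c)))%VF.

Definition lunit V : 'Hom(gone k gT ⊗ V, V) :=
  \sum_g (omega 1%g 1%g g)^-1 *: (vlunit V \o tens_hom \1 (gcomp V g))%VF.

Definition runit V : 'Hom(V ⊗ gone k gT, V) :=
  \sum_g omega g 1%g 1%g *: (vrunit V \o tens_hom (gcomp V g) \1)%VF.

Lemma assocE V W U a b c (v : V) (w : W) (u : U) :
    v \in gr V a -> w \in gr W b -> u \in gr U c ->
  assoc V W U (tens (tens v w : V ⊗ W) u)
    = (omega a b c)^-1 *: (tens v (tens w u : W ⊗ U) : V ⊗ (W ⊗ U)).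
Proof.
move=> va wb uc; rewrite /assoc sum_lfunE (bigD1 a) //= [X in _ + X]big1 => [|i /negPf ia].
  rewrite addr0 sum_lfunE (bigD1 b) //= [X in _ + X]big1 => [|i /negPf ib].
    rewrite addr0 sum_lfunE (bigD1 c) //= [X in _ + X]big1 => [|i /negPf ic].
      rewrite addr0 scale_lfunE comp_lfunE !tens_homE.
      by rewrite (gcomp_id _ va) (gcomp_id _ wb) (gcomp_id _ uc) !eqxx vassocE.
    by rewrite scale_lfunE comp_lfunE !tens_homE (gcomp_id _ uc) ic tens0r linear0 scaler0.
  rewrite sum_lfunE big1 // => j _; rewrite scale_lfunE comp_lfunE !tens_homE.
  by rewrite (gcomp_id _ wb) ib tens0r tens0l linear0 scaler0.
rewrite sum_lfunE big1 // => j _; rewrite sum_lfunE big1 // => l _.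
rewrite scale_lfunE comp_lfunE !tens_homE.
by rewrite (gcomp_id _ va) ia tens0l tens0l linear0 scaler0.
Qed.

Lemma assocVE V W U a b c (v : V) (w : W) (u : U) :
    v \in gr V a -> w \in gr W b -> u \in gr U c ->
  assocV V W U (tens v (tens w u : W ⊗ U))
    = omega a b c *: (tens (tens v w : V ⊗ W) u : (V ⊗ W) ⊗ U).
Proof.
move=> va wb uc; rewrite /assocV sum_lfunE (bigD1 a) //= [X in _ + X]big1 => [|i /negPf ia].
  rewrite addr0 sum_lfunE (bigD1 b) //= [X in _ + X]big1 => [|i /negPf ib].
    rewrite addr0 sum_lfunE (bigD1 c) //= [X in _ + X]big1 => [|i /negPf ic].
      rewrite addr0 scale_lfunE comp_lfunE !tens_homE.
      by rewrite (gcomp_id _ va) (gcomp_id _ wb) (gcomp_id _ uc) !eqxx vassocVE.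
    by rewrite scale_lfunE comp_lfunE !tens_homE (gcomp_id _ uc) ic tens0r tens0r linear0 scaler0.
  rewrite sum_lfunE big1 // => j _; rewrite scale_lfunE comp_lfunE !tens_homE.
  by rewrite (gcomp_id _ wb) ib tens0l tens0r linear0 scaler0.
rewrite sum_lfunE big1 // => j _; rewrite sum_lfunE big1 // => l _.
rewrite scale_lfunE comp_lfunE !tens_homE.
by rewrite (gcomp_id _ va) ia tens0l linear0 scaler0.
Qed.

Lemma lunitE V g (c : gone k gT) (v : V) :
  v \in gr V g -> lunit V (tens c v) = (omega 1%g 1%g g)^-1 *: ((c : k) *: v).
Proof.
move=> vg; rewrite /lunit sum_lfunE (bigD1 g) //= [X in _ + X]big1 => [|i /negPf ig].
  by rewrite addr0 scale_lfunE comp_lfunE tens_homE (gcomp_id _ vg) eqxx id_lfunE vlunitE.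
by rewrite scale_lfunE comp_lfunE tens_homE (gcomp_id _ vg) ig tens0r linear0 scaler0.
Qed.

Lemma runitE V g (c : gone k gT) (v : V) :
  v \in gr V g -> runit V (tens v c) = omega g 1%g 1%g *: ((c : k) *: v).
Proof.
move=> vg; rewrite /runit sum_lfunE (bigD1 g) //= [X in _ + X]big1 => [|i /negPf ig].
  by rewrite addr0 scale_lfunE comp_lfunE tens_homE (gcomp_id _ vg) eqxx id_lfunE vrunitE.
by rewrite scale_lfunE comp_lfunE tens_homE (gcomp_id _ vg) ig tens0l linear0 scaler0.
Qed.

Lemma assoc_ghom V W U : assoc V W U \in ghom ((V ⊗ W) ⊗ U) (V ⊗ (W ⊗ U)).
Proof.
apply: ghom_tens_in => g c x u xg uc; move: x xg.
pose S : {vspace V ⊗ W} :=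
  (linfun (fun x : V ⊗ W => assoc V W U (tens x u)) @^-1: gr (V ⊗ (W ⊗ U)) (g * c)%g)%VS.
have lin : linear (fun x : V ⊗ W => assoc V W U (tens x u)).
  by move=> a x y; rewrite tensDl tensZl linearP.
suff /subvP H : (gr (V ⊗ W) g <= S)%VS by move=> x /H; rewrite -memv_preim (linfunE lin).
apply: tens_gr_sub => a b v w va wb abg; rewrite /S -abg -memv_preim (linfunE lin).
rewrite (assocE va wb uc) memvZ // -mulgA.
exact/gr_tens_in/gr_tens_in.
Qed.

Lemma assocV_ghom V W U : assocV V W U \in ghom (V ⊗ (W ⊗ U)) ((V ⊗ W) ⊗ U).
Proof.
apply: ghom_tens_in => a g v x va; move: x.
pose S : {vspace W ⊗ U} :=
  (linfun (fun x : W ⊗ U => assocV V W U (tens v x)) @^-1: gr ((V ⊗ W) ⊗ U) (a * g)%g)%VS.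
have lin : linear (fun x : W ⊗ U => assocV V W U (tens v x)).
  by move=> c x y; rewrite tensDr tensZr linearP.
suff /subvP H : (gr (W ⊗ U) g <= S)%VS by move=> x /H; rewrite -memv_preim (linfunE lin).
apply: tens_gr_sub => b c w u wb uc bcg; rewrite /S -bcg -memv_preim (linfunE lin).
rewrite (assocVE va wb uc) memvZ // mulgA.
by apply: gr_tens_in => //; apply: gr_tens_in.
Qed.

Hypothesis omega_neq0 : forall a b c, omega a b c != 0.

Lemma assocVK V W U : (assoc V W U \o assocV V W U = \1)%VF.
Proof.
apply: gtens_ext3' => a b c v w u va wb uc; rewrite comp_lfunE (assocVE va wb uc).
by rewrite linearZ /= (assocE va wb uc) scalerA divff // scale1r id_lfunE.
Qed.

Lemma assocK V W U : (assocV V W U \o assoc V W U = \1)%VF.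
Proof.
apply: gtens_ext3 => a b c v w u va wb uc; rewrite comp_lfunE (assocE va wb uc).
by rewrite linearZ /= (assocVE va wb uc) scalerA mulVf // scale1r id_lfunE.
Qed.

End MonoidalStructure.

Section Algebras.

Variables (k : fieldType) (gT : finGroupType) (omega : gT -> gT -> gT -> k).
Implicit Types V W : gvect k gT.

Record algebra := Algebra {
  alg_obj :> gvect k gT;
  alg_mul : 'Hom(alg_obj ⊗ alg_obj, alg_obj);
  alg_unit : 'Hom(gone k gT, alg_obj);
  alg_mul_ghom : alg_mul \in ghom (alg_obj ⊗ alg_obj) alg_obj;
  alg_unit_ghom : alg_unit \in ghom (gone k gT) alg_obj;
  alg_mulA : (alg_mul \o tens_hom alg_mul \1
              = alg_mul \o tens_hom \1 alg_mul \o assoc omega alg_obj alg_obj alg_obj)%VF;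
  alg_mul1l : (alg_mul \o tens_hom alg_unit \1 = lunit omega alg_obj)%VF;
  alg_mul1r : (alg_mul \o tens_hom \1 alg_unit = runit omega alg_obj)%VF }.

Record frobenius_algebra := FrobeniusAlgebra {
  frob_alg :> algebra;
  comul : 'Hom(frob_alg, frob_alg ⊗ frob_alg);
  counit : 'Hom(frob_alg, gone k gT);
  comul_ghom : comul \in ghom frob_alg (frob_alg ⊗ frob_alg);
  counit_ghom : counit \in ghom frob_alg (gone k gT);
  comulA : (assoc omega frob_alg frob_alg frob_alg \o tens_hom comul \1 \o comul
            = tens_hom \1 comul \o comul)%VF;
  comul1l : (lunit omega frob_alg \o tens_hom counit \1 \o comul = \1)%VF;
  comul1r : (runit omega frob_alg \o tens_hom \1 counit \o comul = \1)%VF;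
  frobenius_l : (tens_hom (alg_mul frob_alg) \1
                   \o assocV omega frob_alg frob_alg frob_alg \o tens_hom \1 comul
                 = comul \o alg_mul frob_alg)%VF;
  frobenius_r : (tens_hom \1 (alg_mul frob_alg)
                   \o assoc omega frob_alg frob_alg frob_alg \o tens_hom comul \1
                 = comul \o alg_mul frob_alg)%VF }.

Section DirectSum.

Variables V W : gvect k gT.

Definition dsum_inl : 'Hom(V, (V * W)%type) := linfun (fun v => (v, 0)).
Definition dsum_inr : 'Hom(W, (V * W)%type) := linfun (fun w => (0, w)).
Definition dsum_fst : 'Hom((V * W)%type, V) := linfun fst.
Definition dsum_snd : 'Hom((V * W)%type, W) := linfun snd.

Lemma dsum_inlE v : dsum_inl v = (v, 0).
Proof. by rewrite linfunE // => a x y; congr pair; rewrite /= scaler0 addr0. Qed.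
Lemma dsum_inrE w : dsum_inr w = (0, w).
Proof. by rewrite linfunE // => a x y; congr pair; rewrite /= scaler0 addr0. Qed.
Lemma dsum_fstE x : dsum_fst x = x.1. Proof. by rewrite linfunE. Qed.
Lemma dsum_sndE x : dsum_snd x = x.2. Proof. by rewrite linfunE. Qed.

Definition dsum_gr (g : gT) : {vspace (V * W)%type} :=
  (dsum_inl @: gr V g + dsum_inr @: gr W g)%VS.

Lemma mem_dsum_gr g x : (x \in dsum_gr g) = (x.1 \in gr V g) && (x.2 \in gr W g).
Proof.
apply/idP/andP => [/memv_addP[_ /memv_imgP[v vg ->] [_ /memv_imgP[w wg ->] ->]] | [vg wg]].
  by rewrite dsum_inlE dsum_inrE /= addr0 add0r.
apply/memv_addP; exists (dsum_inl x.1); first exact: memv_img.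
exists (dsum_inr x.2); first exact: memv_img.
by rewrite dsum_inlE dsum_inrE; case: x {vg wg} => x1 x2; congr pair; rewrite ?addr0 ?add0r.
Qed.

Let dsum_pr g : 'End((V * W)%type) :=
  ((dsum_inl \o gcomp V g \o dsum_fst) + (dsum_inr \o gcomp W g \o dsum_snd))%VF.

Let dsum_prE g x : dsum_pr g x = (gcomp V g x.1, gcomp W g x.2).
Proof.
rewrite add_lfunE !comp_lfunE dsum_fstE dsum_sndE dsum_inlE dsum_inrE.
by congr pair; rewrite ?addr0 ?add0r.
Qed.

Fact dsum_grading : is_grading dsum_gr.
Proof.
apply: (@is_grading_of _ _ _ _ dsum_pr) => [x|g x|g h x].
- under eq_bigr do rewrite dsum_prE.
  rewrite [LHS]surjective_pairing [RHS]surjective_pairing; congr pair.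
    by rewrite -dsum_fstE linear_sum -[RHS]gcomp_sum; apply: eq_bigr => g _; rewrite /= dsum_fstE.
  by rewrite -dsum_sndE linear_sum -[RHS]gcomp_sum; apply: eq_bigr => g _; rewrite /= dsum_sndE.
- by rewrite mem_dsum_gr dsum_prE !gcomp_in.
rewrite mem_dsum_gr dsum_prE => /andP[/gcomp_id-> /gcomp_id->].
by case: eqP => //; case: x.
Qed.

Definition dsum : gvect k gT := Gvect dsum_grading.

End DirectSum.

Section DirectSumAlgebra.

Variables B C : algebra.
Let S := dsum B C.

(* Componentwise multiplication: (b, c) (b', c') = (b b', c c'), with unit
   (1, 1); see dsum_mulE. *)
Definition dsum_mul : 'Hom(S ⊗ S, S) :=
  ((dsum_inl B C \o alg_mul B \o tens_hom (dsum_fst B C) (dsum_fst B C))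
   + (dsum_inr B C \o alg_mul C \o tens_hom (dsum_snd B C) (dsum_snd B C)))%VF.

Definition dsum_unit : 'Hom(gone k gT, S) :=
  ((dsum_inl B C \o alg_unit B) + (dsum_inr B C \o alg_unit C))%VF.

Lemma dsum_mulE (x y : S) :
  dsum_mul (tens x y) = (alg_mul B (tens x.1 y.1), alg_mul C (tens x.2 y.2)).
Proof.
rewrite add_lfunE !comp_lfunE !tens_homE !dsum_fstE !dsum_sndE dsum_inlE dsum_inrE.
by congr pair; rewrite ?addr0 ?add0r.
Qed.

Lemma dsum_unitE (c : gone k gT) : dsum_unit c = (alg_unit B c, alg_unit C c).
Proof.
rewrite add_lfunE !comp_lfunE dsum_inlE dsum_inrE.
by congr pair; rewrite ?addr0 ?add0r.
Qed.

Fact dsum_mul_ghom : dsum_mul \in ghom (S ⊗ S) S.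
Proof.
apply: ghom_tens_in => a b x y; rewrite !mem_dsum_gr dsum_mulE.
move=> /andP[x1 x2] /andP[y1 y2].
by rewrite (ghomP _ (alg_mul_ghom B)) ?(ghomP _ (alg_mul_ghom C)) //; apply: gr_tens_in.
Qed.

Fact dsum_unit_ghom : dsum_unit \in ghom (gone k gT) S.
Proof.
apply/ghomP=> g c cg; rewrite mem_dsum_gr dsum_unitE.
by rewrite (ghomP _ (alg_unit_ghom B)) ?(ghomP _ (alg_unit_ghom C)).
Qed.

Fact dsum_mulA :
  (dsum_mul \o tens_hom dsum_mul \1 = dsum_mul \o tens_hom \1 dsum_mul \o assoc omega S S S)%VF.
Proof.
apply: gtens_ext3 => a b c x y z xa yb zc.
rewrite !comp_lfunE tens_homE id_lfunE (assocE _ xa yb zc) !linearZ /= tens_homE id_lfunE.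
rewrite !dsum_mulE /=; move: xa yb zc.
rewrite !mem_dsum_gr => /andP[x1 x2] /andP[y1 y2] /andP[z1 z2].
have /lfunP/(_ (tens (tens x.1 y.1) z.1)) := alg_mulA B.
rewrite !comp_lfunE tens_homE id_lfunE (assocE _ x1 y1 z1) !linearZ /= tens_homE id_lfunE => ->.
have /lfunP/(_ (tens (tens x.2 y.2) z.2)) := alg_mulA C.
by rewrite !comp_lfunE tens_homE id_lfunE (assocE _ x2 y2 z2) !linearZ /= tens_homE id_lfunE => ->.
Qed.

Fact dsum_mul1l : (dsum_mul \o tens_hom dsum_unit \1 = lunit omega S)%VF.
Proof.
apply: gtens_ext => a b c x _ xb; rewrite (lunitE _ _ xb).
rewrite comp_lfunE tens_homE id_lfunE dsum_unitE dsum_mulE /=; move: xb.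
rewrite mem_dsum_gr => /andP[x1 x2].
have /lfunP/(_ (tens c x.1)) := alg_mul1l B.
rewrite comp_lfunE tens_homE id_lfunE (lunitE _ _ x1) => ->.
have /lfunP/(_ (tens c x.2)) := alg_mul1l C.
by rewrite comp_lfunE tens_homE id_lfunE (lunitE _ _ x2) => ->.
Qed.

Fact dsum_mul1r : (dsum_mul \o tens_hom \1 dsum_unit = runit omega S)%VF.
Proof.
apply: gtens_ext => a b x c xa _; rewrite (runitE _ _ xa).
rewrite comp_lfunE tens_homE id_lfunE dsum_unitE dsum_mulE /=; move: xa.
rewrite mem_dsum_gr => /andP[x1 x2].
have /lfunP/(_ (tens x.1 c)) := alg_mul1r B.
rewrite comp_lfunE tens_homE id_lfunE (runitE _ _ x1) => ->.
have /lfunP/(_ (tens x.2 c)) := alg_mul1r C.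
by rewrite comp_lfunE tens_homE id_lfunE (runitE _ _ x2) => ->.
Qed.

Definition dsum_algebra : algebra :=
  Algebra dsum_mul_ghom dsum_unit_ghom dsum_mulA dsum_mul1l dsum_mul1r.

End DirectSumAlgebra.

Definition algebra_iso (A B : algebra) : Prop :=
  exists (f : 'Hom(A, B)) (f' : 'Hom(B, A)),
    [/\ f \in ghom A B, f' \in ghom B A,
        (f' \o f = \1)%VF, (f \o f' = \1)%VF
      & (f \o alg_mul A = alg_mul B \o tens_hom f f)%VF
        /\ (f \o alg_unit A = alg_unit B)%VF].

Definition nontrivial_algebra (A : algebra) : Prop := \dim {:A} <> 0%N.

Definition connected (A : algebra) : Prop := \dim (ghom (gone k gT) A) = 1%N.

Definition indecomposable (A : algebra) : Prop :=
  forall B C : algebra, nontrivial_algebra B -> nontrivial_algebra C ->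
  ~ algebra_iso A (dsum_algebra B C).

Definition separable (A : algebra) : Prop :=
  exists D : 'Hom(A, A ⊗ A),
    [/\ D \in ghom A (A ⊗ A),
        (alg_mul A \o D = \1)%VF,
        (tens_hom \1 (alg_mul A) \o assoc omega A A A \o tens_hom D \1
         = D \o alg_mul A)%VF
      & (D \o alg_mul A
         = tens_hom (alg_mul A) \1 \o assocV omega A A A \o tens_hom \1 D)%VF].

Definition special (A : frobenius_algebra) : Prop :=
  (alg_mul A \o comul A = \1)%VF /\
  exists2 phi : k, phi != 0 & (counit A \o alg_unit A = phi *: \1)%VF.

End Algebras.

Section Cochains.

Variables (k : fieldType) (gT : finGroupType).

(* Cochains with values in the multiplicative group of k are functions to k
   that vanish nowhere. *)
Record normalized_3cocycle (omega : gT -> gT -> gT -> k) : Prop := Normalized3Cocycle {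
  cocycle3_neq0 : forall a b c, omega a b c != 0;
  cocycle3_eq : forall a b c d,
    omega (a * b)%g c d * omega a b (c * d)%g
      = omega a b c * omega a (b * c)%g d * omega b c d;
  cocycle3_norm : forall a b,
    [/\ omega 1%g a b = 1, omega a 1%g b = 1 & omega a b 1%g = 1] }.

Definition cochain2 (psi : gT -> gT -> k) : Prop := forall a b, psi a b != 0.

Record normalized_2cochain (psi : gT -> gT -> k) : Prop := Normalized2Cochain {
  cochain2_neq0 : cochain2 psi;
  cochain2_norm : forall a, psi 1%g a = 1 /\ psi a 1%g = 1 }.

(* d psi = w *)
Definition has_coboundary (psi : gT -> gT -> k) (w : gT -> gT -> gT -> k) : Prop :=
  forall a b c,
    psi a (b * c)%g * psi b c = w a b c * psi (a * b)%g c * psi a b.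

Definition trivial_class (w : gT -> gT -> gT -> k) : Prop :=
  exists2 psi, cochain2 psi & has_coboundary psi w.

Definition restrict3 (L : {group gT}) (omega : gT -> gT -> gT -> k)
    (a b c : [subg L]) : k :=
  omega (sgval a) (sgval b) (sgval c).

End Cochains.

Arguments restrict3 {k gT} L omega a b c.

Section TwistedGroupAlgebra.

Variables (k : fieldType) (gT : finGroupType) (L : {group gT}).

(* A(L, psi) is the sum of the delta_g for g in L, as an object: the functions
   on L, graded so that the basis vector bas h has degree h. *)
Definition bas (h : [subg L]) : {ffun [subg L] -> k^o} := [ffun i => (i == h)%:R].

Definition tga_gr (g : gT) : {vspace {ffun [subg L] -> k^o}} :=
  (\sum_(h : [subg L] | sgval h == g) <[bas h]>)%VS.

Lemma bas_sum (x : {ffun [subg L] -> k^o}) : x = \sum_h (x h : k) *: bas h.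
Proof.
apply/ffunP=> i; rewrite sum_ffunE (bigD1 i) //= !ffunE eqxx big1 => [|j /negPf ji].
  by rewrite addr0 -[RHS]/(_ * _) mulr1.
by rewrite !ffunE eq_sym ji scaler0.
Qed.

Definition tga_lift (V : vectType k) (F : [subg L] -> V) :
    'Hom({ffun [subg L] -> k^o}, V) :=
  linfun (fun x : {ffun [subg L] -> k^o} => \sum_h (x h : k) *: F h).

Lemma tga_liftE (V : vectType k) (F : [subg L] -> V) h : tga_lift F (bas h) = F h.
Proof.
rewrite linfunE => [|a x y].
  rewrite (bigD1 h) //= ffunE eqxx scale1r big1 ?addr0 // => i /negPf ih.
  by rewrite ffunE ih scale0r.
rewrite scaler_sumr -big_split; apply: eq_bigr => i _ /=.
by rewrite !ffunE scalerDl scalerA.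
Qed.

Lemma tga_ext (V : vectType k) (f f' : 'Hom({ffun [subg L] -> k^o}, V)) :
  (forall h, f (bas h) = f' (bas h)) -> f = f'.
Proof.
move=> ff'; apply/lfunP=> x; rewrite (bas_sum x) !linear_sum.
by apply: eq_bigr => h _; rewrite !linearZ /= ff'.
Qed.

Let tga_pr (g : gT) : 'End({ffun [subg L] -> k^o}) :=
  tga_lift (fun h => if sgval h == g then bas h else 0).

Fact tga_grading : is_grading tga_gr.
Proof.
apply: (@is_grading_of _ _ _ _ tga_pr) => [x|g x|g h x].
- rewrite -sum_lfunE (_ : \sum_g _ = \1%VF) ?id_lfunE //; apply: tga_ext => h.
  rewrite id_lfunE sum_lfunE (bigD1 (sgval h)) //= tga_liftE eqxx.
  by rewrite big1 ?addr0 // => g /negPf gh; rewrite tga_liftE eq_sym gh.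
- rewrite (bas_sum x) linear_sum; apply: memv_suml => h _.
  rewrite linearZ /= tga_liftE memvZ //; case: eqP => [hg|]; last by rewrite mem0v.
  by rewrite memvE (sumv_sup h) //; apply/eqP.
move: x; suff H : (tga_gr g <= lker (tga_pr h - (if h == g then \1%VF else 0))%R)%VS.
  move=> x /(subvP H); rewrite memv_ker !lfun_simp subr_eq0 => /eqP->.
  by case: eqP; rewrite lfunE.
apply/subv_sumP=> i /eqP <-; rewrite -memvE memv_ker !lfun_simp subr_eq0 tga_liftE.
by case: (eqVneq h (sgval i)) => _; rewrite ?id_lfunE ?zero_lfunE.
Qed.

Definition tga_obj : gvect k gT := Gvect tga_grading.

Lemma bas_in h : bas h \in gr tga_obj (sgval h).
Proof. by rewrite memvE (sumv_sup h). Qed.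

Lemma tga_in g (U : {vspace tga_obj}) :
  (forall h, sgval h = g -> bas h \in U) -> (gr tga_obj g <= U)%VS.
Proof. by move=> H; apply/subv_sumP=> h /eqP/H. Qed.

Lemma tga_ext2 (V : vectType k) (f f' : 'Hom(tga_obj ⊗ tga_obj, V)) :
  (forall h i, f (tens (bas h) (bas i)) = f' (tens (bas h) (bas i))) -> f = f'.
Proof.
move=> ff'; apply: tens_ext => x y.
rewrite (bas_sum x) (bas_sum y) tens_suml !linear_sum; apply: eq_bigr => h _.
rewrite tensZl !linearZ /=; congr (_ *: _).
rewrite tens_sumr !linear_sum; apply: eq_bigr => i _.
by rewrite tensZr !linearZ /= ff'.
Qed.

Lemma tga_ext3 (V : vectType k)
    (f f' : 'Hom((tga_obj ⊗ tga_obj) ⊗ tga_obj, V)) :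
  (forall h i j, f (tens (tens (bas h) (bas i)) (bas j))
                 = f' (tens (tens (bas h) (bas i)) (bas j))) -> f = f'.
Proof.
move=> ff'; apply: gtens_ext3 => a b c x y z _ _ _.
rewrite (bas_sum x) (bas_sum y) (bas_sum z).
rewrite [X in tens X _]tens_suml tens_suml !linear_sum; apply: eq_bigr => h _.
rewrite [X in tens X _]tens_sumr tens_suml !linear_sum; apply: eq_bigr => i _.
rewrite tens_sumr !linear_sum; apply: eq_bigr => j _.
rewrite tensZr [X in tens X _]tensZl [X in tens (_ *: X) _]tensZr !tensZl !linearZ /=.
by rewrite ff'.
Qed.

Variable psi : [subg L] -> [subg L] -> k.

Definition tga_mul : 'Hom(tga_obj ⊗ tga_obj, tga_obj) :=
  tlift (fun x y : {ffun [subg L] -> k^o} =>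
    \sum_g \sum_h ((x g : k) * (y h : k)) *: (psi g h *: bas (g * h)%g)).

Definition tga_unit : 'Hom(gone k gT, tga_obj) :=
  linfun (fun c : k^o => (c : k) *: bas 1%g).

Definition tga_comul : 'Hom(tga_obj, tga_obj ⊗ tga_obj) :=
  tga_lift (fun g => (#|L|%:R^-1 : k) *:
    \sum_h (psi (g * h)%g (h^-1)%g)^-1 *: tens (bas (g * h)%g) (bas (h^-1)%g)).

Definition tga_counit : 'Hom(tga_obj, gone k gT) :=
  tga_lift (fun g => ((g == 1%g)%:R * #|L|%:R : k^o)).

Lemma tga_mulE g h : tga_mul (tens (bas g) (bas h)) = psi g h *: bas (g * h)%g.
Proof.
rewrite tliftE.
  rewrite (bigD1 g) //= (bigD1 h) //= !ffunE !eqxx mul1r scale1r.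
  rewrite !big1 ?addr0 // => [i /negPf ig|i /negPf ih].
    by rewrite big1 // => j _; rewrite !ffunE ig mul0r scale0r.
  by rewrite !ffunE ih mulr0 scale0r.
split=> [w|w] a x y; rewrite scaler_sumr -big_split; apply: eq_bigr => i _ /=;
  rewrite scaler_sumr -big_split; apply: eq_bigr => j _ /=;
  move: (psi _ _ *: _) => v; rewrite !ffunE -[a *: _]/(a * _ : k) scalerA -scalerDl; congr (_ *: _).
  by rewrite mulrDl mulrA.
by rewrite mulrDr mulrCA.
Qed.

Lemma tga_unitE (c : gone k gT) : tga_unit c = (c : k) *: bas 1%g.
Proof. by rewrite linfunE // => a x y; rewrite scalerDl scalerA. Qed.

Lemma tga_comulE g : tga_comul (bas g) = (#|L|%:R^-1 : k) *:
  \sum_h (psi (g * h)%g (h^-1)%g)^-1 *: tens (bas (g * h)%g) (bas (h^-1)%g).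
Proof. exact: tga_liftE. Qed.

Lemma tga_counitE g : tga_counit (bas g) = (g == 1%g)%:R * #|L|%:R.
Proof. exact: tga_liftE. Qed.

Lemma sg1 : sgval (1%g : [subg L]) = 1%g. Proof. by []. Qed.
Lemma sgM (g h : [subg L]) : sgval (g * h)%g = (sgval g * sgval h)%g.
Proof. by []. Qed.

Fact tga_mul_ghom : tga_mul \in ghom (tga_obj ⊗ tga_obj) tga_obj.
Proof.
apply/ghomP => g x; move: x; suff /subvP H : (gr (tga_obj ⊗ tga_obj) g <= tga_mul @^-1: gr tga_obj g)%VS.
  by move=> x /H; rewrite -memv_preim.
apply: tens_gr_sub => a b v w va wb <-; rewrite -memv_preim.
have sub1 (i : [subg L]) : (gr tga_obj b <=
    linfun (fun y : tga_obj => tga_mul (tens (bas i) y)) @^-1: gr tga_obj (sgval i * b)%g)%VS.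
  have lin : linear (fun y : tga_obj => tga_mul (tens (bas i) y)).
    by move=> c y z; rewrite tensDr tensZr linearP.
  apply: tga_in => j <-; rewrite -memv_preim (linfunE lin) tga_mulE memvZ // -sgM.
  exact: bas_in.
have lin : linear (fun x : tga_obj => tga_mul (tens x w)).
  by move=> c y z; rewrite tensDl tensZl linearP.
have : (gr tga_obj a <=
    linfun (fun x : tga_obj => tga_mul (tens x w)) @^-1: gr tga_obj (a * b)%g)%VS.
  apply: tga_in => i <-; rewrite -memv_preim (linfunE lin).
  have := subvP (sub1 i) _ wb; rewrite -memv_preim linfunE //.
  by move=> c y z; rewrite tensDr tensZr linearP.
by move/subvP/(_ _ va); rewrite -memv_preim (linfunE lin).
Qed.

Fact tga_unit_ghom : tga_unit \in ghom (gone k gT) tga_obj.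
Proof.
apply/ghomP=> g c; rewrite /= /delta_gr; case: eqP => [-> _|_].
  by rewrite tga_unitE memvZ // -sg1 bas_in.
by rewrite memv0 => /eqP->; rewrite linear0 mem0v.
Qed.

Fact tga_comul_ghom : tga_comul \in ghom tga_obj (tga_obj ⊗ tga_obj).
Proof.
apply/ghomP=> g x; suff /subvP H : (gr tga_obj g <= tga_comul @^-1: gr (tga_obj ⊗ tga_obj) g)%VS.
  by move/H; rewrite -memv_preim.
apply: tga_in => h <-; rewrite -memv_preim tga_comulE memvZ //; apply: memv_suml => i _.
have -> : sgval h = (sgval (h * i) * sgval i^-1)%g by rewrite -sgM mulgK.
by rewrite memvZ // gr_tens_in ?bas_in.
Qed.

Fact tga_counit_ghom : tga_counit \in ghom tga_obj (gone k gT).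
Proof.
apply/ghomP=> g x; suff /subvP H : (gr tga_obj g <= tga_counit @^-1: gr (gone k gT) g)%VS.
  by move/H; rewrite -memv_preim.
apply: tga_in => h <-; rewrite -memv_preim tga_counitE /= /delta_gr.
have [->|h1] := eqVneq h 1%g; first by rewrite eqxx memvf.
by rewrite mul0r mem0v.
Qed.

Variable omega : gT -> gT -> gT -> k.
Hypothesis char0 : [pchar k] =i pred0.
Hypothesis omegaP : normalized_3cocycle omega.
Hypothesis psiP : normalized_2cochain psi.
Hypothesis dpsi : has_coboundary psi (restrict3 L omega).

Let psi0 := cochain2_neq0 psiP.
Let om0 := cocycle3_neq0 omegaP.

Lemma card_neq0 : #|L|%:R != 0 :> k.
Proof. by have /pcharf0P-> := char0; rewrite -lt0n cardG_gt0. Qed.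

Fact tga_mulA : (tga_mul \o tens_hom tga_mul \1
  = tga_mul \o tens_hom \1 tga_mul \o assoc omega tga_obj tga_obj tga_obj)%VF.
Proof.
apply: tga_ext3 => g h i; rewrite !comp_lfunE tens_homE id_lfunE.
rewrite (assocE _ (bas_in g) (bas_in h) (bas_in i)) !linearZ /= tens_homE id_lfunE.
rewrite !tga_mulE tensZl tensZr !linearZ /= !tga_mulE !scalerA mulgA; congr (_ *: _).
apply: (mulfI (om0 (sgval g) (sgval h) (sgval i))).
rewrite [psi h i / _]mulrC -[_^-1 * _ * _]mulrA mulVKf // [psi h i * _]mulrC.
by rewrite (dpsi g h i) -mulrA [psi g h * _]mulrC.
Qed.

Fact tga_mul1l : (tga_mul \o tens_hom tga_unit \1 = lunit omega tga_obj)%VF.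
Proof.
apply: tens_ext => c x; rewrite (bas_sum x) !tens_sumr !linear_sum; apply: eq_bigr => h _.
rewrite !tensZr !linearZ /= (lunitE _ _ (bas_in h)) comp_lfunE tens_homE id_lfunE tga_unitE.
rewrite tensZl linearZ /= tga_mulE mul1g (cochain2_norm psiP h).1 scale1r.
by have [-> _ _] := cocycle3_norm omegaP 1%g (sgval h); rewrite invr1 scale1r.
Qed.

Fact tga_mul1r : (tga_mul \o tens_hom \1 tga_unit = runit omega tga_obj)%VF.
Proof.
apply: tens_ext => x c; rewrite (bas_sum x) !tens_suml !linear_sum; apply: eq_bigr => h _.
rewrite !tensZl !linearZ /= (runitE _ _ (bas_in h)) comp_lfunE tens_homE id_lfunE tga_unitE.
rewrite tensZr linearZ /= tga_mulE mulg1 (cochain2_norm psiP h).2 scale1r.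
by have [_ -> _] := cocycle3_norm omegaP (sgval h) 1%g; rewrite scale1r.
Qed.

Definition tga_algebra : algebra omega :=
  Algebra tga_mul_ghom tga_unit_ghom tga_mulA tga_mul1l tga_mul1r.

Fact tga_comulA :
  (assoc omega tga_obj tga_obj tga_obj \o tens_hom tga_comul \1 \o tga_comul
   = tens_hom \1 tga_comul \o tga_comul)%VF.
Proof.
apply: tga_ext => g; rewrite !comp_lfunE tga_comulE !linearZ /=; congr (_ *: _).
pose n : k := #|L|%:R^-1.
have coefE (x y : k) : x^-1 * n * y^-1 = n * (x * y)^-1 by rewrite invfM mulrA [n * _]mulrC.
have coefE3 (x y z : k) : n / x / y / z = n * (x * y * z)^-1 by rewrite !invfM !mulrA.
transitivity (\sum_h \sum_i
    (n * (psi (g * (h * i))%g ((h * i)^-1)%g * psi ((h * i)^-1 * h)%g (h^-1)%g)^-1) *: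
      tens (bas (g * (h * i))%g) (tens (bas ((h * i)^-1 * h)%g) (bas (h^-1)%g)));
    last first.
  rewrite linear_sum.
  under [RHS]eq_bigr => p _.
    rewrite linearZ /= tens_homE id_lfunE tga_comulE tensZr tens_sumr scalerA scaler_sumr.
    under eq_bigr => h _ do rewrite tensZr scalerA coefE.
    over.
  rewrite [RHS]exchange_big /=; apply: eq_bigr => h _.
  by rewrite [RHS](reindex_inj (mulgI h)).
rewrite -comp_lfunE linear_sum; apply: eq_bigr => h _.
rewrite linearZ /= comp_lfunE tens_homE id_lfunE tga_comulE tensZl tens_suml !linearZ /= scalerA.
rewrite linear_sum scaler_sumr; apply: eq_bigr => i _.
rewrite tensZl linearZ /= (assocE _ (bas_in _) (bas_in _) (bas_in _)) !scalerA.
rewrite coefE3 invMg mulgKV mulgA; congr ((_ * _^-1) *: _).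
rewrite (dpsi (g * h * i)%g (i^-1)%g (h^-1)%g) mulgK -[RHS]mulrA [RHS]mulrC.
by [].
Qed.

Fact tga_comul1l :
  (lunit omega tga_obj \o tens_hom tga_counit \1 \o tga_comul = \1)%VF.
Proof.
apply: tga_ext => g; rewrite !comp_lfunE id_lfunE tga_comulE !linearZ /=.
rewrite -comp_lfunE linear_sum (bigD1 (g^-1)%g) //= [X in _ + X]big1 => [|h hg].
  rewrite addr0 linearZ /= comp_lfunE tens_homE id_lfunE tga_counitE mulgV eqxx invgK.
  rewrite (lunitE _ _ (bas_in g)) (cochain2_norm psiP g).1 invr1 scale1r mul1r.
  have [-> _ _] := cocycle3_norm omegaP 1%g (sgval g).
  by rewrite invr1 scale1r scalerA mulVf ?card_neq0 // scale1r.
rewrite linearZ /= comp_lfunE tens_homE id_lfunE tga_counitE.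
by rewrite -eq_invg_mul eq_sym (negPf hg) mul0r tens0l linear0 scaler0.
Qed.

Fact tga_comul1r :
  (runit omega tga_obj \o tens_hom \1 tga_counit \o tga_comul = \1)%VF.
Proof.
apply: tga_ext => g; rewrite !comp_lfunE id_lfunE tga_comulE !linearZ /=.
rewrite -comp_lfunE linear_sum (bigD1 1%g) //= [X in _ + X]big1 => [|h /negPf hg].
  rewrite addr0 linearZ /= comp_lfunE tens_homE id_lfunE tga_counitE invg1 eqxx mulg1.
  rewrite (runitE _ _ (bas_in g)) (cochain2_norm psiP g).2 invr1 scale1r mul1r.
  have [_ -> _] := cocycle3_norm omegaP (sgval g) 1%g.
  by rewrite scale1r scalerA mulVf ?card_neq0 // scale1r.
rewrite linearZ /= comp_lfunE tens_homE id_lfunE tga_counitE.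
by rewrite invg_eq1 hg mul0r tens0r linear0 scaler0.
Qed.

Fact tga_frobenius_l :
  (tens_hom tga_mul \1 \o assocV omega tga_obj tga_obj tga_obj \o tens_hom \1 tga_comul
   = tga_comul \o tga_mul)%VF.
Proof.
apply: tga_ext2 => f g; rewrite !comp_lfunE tens_homE id_lfunE tga_mulE tga_comulE.
rewrite linearZ /= tga_comulE tensZr !linearZ /=; congr (_ *: _).
rewrite tens_sumr -comp_lfunE linear_sum scaler_sumr; apply: eq_bigr => h _.
rewrite tensZr linearZ /= comp_lfunE (assocVE _ (bas_in _) (bas_in _) (bas_in _)).
rewrite linearZ /= tens_homE id_lfunE tga_mulE tensZl !scalerA mulgA.
congr (_ *: _); apply: (canRL (mulfK (psi0 _ _))).
apply: (mulfI (psi0 (g * h)%g (h^-1)%g)); rewrite -!mulrA mulVKf // [RHS]mulrC.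
have := dpsi f (g * h)%g (h^-1)%g; rewrite mulgK mulgA => ->.
by rewrite -mulrA [psi f _ * _]mulrC.
Qed.

Fact tga_frobenius_r :
  (tens_hom \1 tga_mul \o assoc omega tga_obj tga_obj tga_obj \o tens_hom tga_comul \1
   = tga_comul \o tga_mul)%VF.
Proof.
apply: tga_ext2 => f g; rewrite !comp_lfunE tens_homE id_lfunE tga_mulE tga_comulE.
rewrite linearZ /= tga_comulE tensZl !linearZ /=; congr (_ *: _).
rewrite tens_suml -comp_lfunE linear_sum scaler_sumr [RHS](reindex_inj (mulgI (g^-1)%g)).
apply: eq_bigr => h _ /=.
rewrite tensZl linearZ /= comp_lfunE (assocE _ (bas_in _) (bas_in _) (bas_in _)).
rewrite linearZ /= tens_homE id_lfunE tga_mulE tensZr !scalerA invMg invgK mulgA mulgK.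
congr (_ *: _); apply: (canRL (mulfK (psi0 _ _))).
have := dpsi (f * h)%g (h^-1)%g g; rewrite mulgK => E.
rewrite -!mulrA [psi (h^-1)%g g * _]mulrC E -mulrA mulKf //.
by rewrite [psi f g * _]mulrC mulKf.
Qed.

Definition twisted_group_algebra : frobenius_algebra omega :=
  @FrobeniusAlgebra _ _ omega tga_algebra tga_comul tga_counit
    tga_comul_ghom tga_counit_ghom tga_comulA tga_comul1l tga_comul1r
    tga_frobenius_l tga_frobenius_r.

End TwistedGroupAlgebra.

(* Main.v *)
Require Import Defs.
From mathcomp Require Import all_boot all_order all_fingroup all_algebra.

Set Implicit Arguments.
Unset Strict Implicit.
Unset Printing Implicit Defensive.

Import GRing.Theory.
Local Open Scope ring_scope.

(** A morphism from the unit object to [A] amounts to a vector of degree $e$ in [A], and these form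
    the line through $\delta_e$; this gives connectedness ([tga_connected]). Indecomposability is
    then formal: the units of two nontrivial summands would yield two independent such morphisms
    ([connected_indecomposable]). For specialness ([tga_special]), the factors $\psi$ in
    $m\Delta(\delta_g)$ cancel and leave $|L|$ copies of $\delta_g$, averaged by $|L|^{-1}$.
    Separability is formal again ([special_separable]): specialness makes $\Delta$ a section of $m$,
    and the Frobenius relations are the required bimodule conditions. *)

Section AlgebrasInVecG.

Variables (k : fieldType) (gT : finGroupType) (omega : gT -> gT -> gT -> k).

Lemma dsum_inl_ghom (V W : gvect k gT) : dsum_inl V W \in ghom V (dsum V W).
Proof. by apply/ghomP=> g v vg; rewrite mem_dsum_gr dsum_inlE vg mem0v. Qed.

Lemma dsum_inr_ghom (V W : gvect k gT) : dsum_inr V W \in ghom W (dsum V W).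
Proof. by apply/ghomP=> g w wg; rewrite mem_dsum_gr dsum_inrE wg mem0v. Qed.

Hypothesis omega_neq0 : forall a b c, omega a b c != 0.

(** If the unit map killed $1$, the left unit law would make a nonzero multiple of every homogeneous
    vector vanish, so [B] would be zero. *)
Lemma alg_unit_neq0 (B : algebra omega) :
  nontrivial_algebra B -> alg_unit B (1 : k^o) != 0.
Proof.
move=> Bnt; apply: contra_notN Bnt => /eqP u0; apply/eqP.
rewrite dimv_eq0 -subv0; apply/subvP=> v _; rewrite memv0 -(gcomp_sum v).
rewrite big1 // => g _; have vg := gcomp_in g v.
have /lfunP/(_ (tens (1 : k^o) (gcomp B g v))) := alg_mul1l B.
rewrite comp_lfunE tens_homE id_lfunE u0 tens0l linear0 (lunitE _ _ vg) scale1r.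
by move/esym/eqP; rewrite scaler_eq0 invr_eq0 (negPf (omega_neq0 _ _ _)) => /eqP.
Qed.

(* A decomposition B (+) C would give two linearly independent morphisms from
   the unit object, namely the units of B and of C. *)
Lemma connected_indecomposable (A : algebra omega) :
  connected A -> indecomposable A.
Proof.
move=> A1 B C Bnt Cnt [f [f' [fh f'h _ ff' _]]].
pose p := (f' \o (dsum_inl B C \o alg_unit B))%VF.
pose q := (f' \o (dsum_inr B C \o alg_unit C))%VF.
have ph : p \in ghom (gone k gT) A.
  exact: ghom_comp f'h (ghom_comp (dsum_inl_ghom B C) (alg_unit_ghom B)).
have qh : q \in ghom (gone k gT) A.
  exact: ghom_comp f'h (ghom_comp (dsum_inr_ghom B C) (alg_unit_ghom C)).
have ff'E x : f (f' x) = x by rewrite -comp_lfunE ff' id_lfunE.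
have fp : f (p (1 : k^o)) = (alg_unit B (1 : k^o), 0).
  by rewrite !comp_lfunE ff'E dsum_inlE.
have fq : f (q (1 : k^o)) = (0, alg_unit C (1 : k^o)).
  by rewrite !comp_lfunE ff'E dsum_inrE.
have p0 : p != 0.
  apply: contra_neq (alg_unit_neq0 Bnt) => p0.
  by move: fp; rewrite p0 zero_lfunE linear0 => -[].
(* Connectedness makes the Hom space one-dimensional, so the nonzero [p] spans it and [q] is a
   multiple of [p]. *)
have lineE : (<[p]> = ghom (gone k gT) A)%VS.
  by apply/eqP; rewrite eqEdim -memvE ph dim_vline p0 A1.
move: qh; rewrite -lineE => /vlineP[c qE].
have := alg_unit_neq0 Cnt; move/eqP; apply.
(* The second component of [f (p 1)] is zero, which forces the unit of [C] to vanish. *)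
move: fq; rewrite qE scale_lfunE linearZ /= fp => -[_ <-].
exact: scaler0.
Qed.

Lemma special_separable (A : frobenius_algebra omega) :
  special A -> separable A.
Proof.
case=> mD _; exists (comul A); split=> //; first exact: comul_ghom.
  exact: frobenius_r.
by rewrite frobenius_l.
Qed.

End AlgebrasInVecG.

Section TwistedGroupAlgebra.

Variables (k : fieldType) (gT : finGroupType) (L : {group gT}).

(** The embedding of [L] in the group is injective, so only the index $e$ contributes in degree
    $e$. *)
Lemma tga_gr1 : gr (tga_obj k L) 1%g = <[bas k 1%g]>%VS.
Proof.
rewrite /= /tga_gr (bigD1 1%g) //= big1 ?addv0 // => h /andP[/eqP h1 /eqP[]].
exact: val_inj.
Qed.

Variable omega : gT -> gT -> gT -> k.
Hypotheses (char0 : [pchar k] =i pred0) (omegaP : normalized_3cocycle omega).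
Variable psi : [subg L] -> [subg L] -> k.
Hypotheses (psiP : normalized_2cochain psi)
  (dpsi : has_coboundary psi (restrict3 L omega)).

Let A := twisted_group_algebra char0 omegaP psiP dpsi.

Lemma tga_connected : connected A.
Proof.
have uE : (ghom (gone k gT) A = <[tga_unit k L]>)%VS.
  apply/eqP; rewrite eqEsubv -memvE tga_unit_ghom andbT.
  apply/subvP=> f /ghomP fh; apply/vlineP.
  have : f (1 : k^o) \in gr A 1%g by apply: fh; rewrite /= /delta_gr eqxx memvf.
  rewrite [gr A _]tga_gr1 => /vlineP[c fc]; exists c; apply/lfunP=> x.
  (* By linearity [f] is determined by its value at $1$, since $x = x \cdot 1$ in the unit
     object. *)
  rewrite scale_lfunE tga_unitE scalerA mulrC -scalerA -fc -linearZ.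
  by congr (f _); rewrite -[RHS]/(_ * _) mulr1.
rewrite /connected uE dim_vline; suff -> : tga_unit k L != 0 by [].
apply/eqP=> /lfunP/(_ (1 : k^o)); rewrite tga_unitE zero_lfunE scale1r.
by move/ffunP/(_ 1%g)/eqP; rewrite !ffunE eqxx oner_eq0.
Qed.

Lemma tga_special : special A.
Proof.
split.
  apply: tga_ext => g; rewrite comp_lfunE id_lfunE tga_comulE linearZ /= linear_sum.
  (* In each summand $\psi(gh,h^{-1})$ cancels its inverse and $(gh)h^{-1} = g$, so the summand does
     not depend on [h]. *)
  under eq_bigr => h _.
    rewrite linearZ /= tga_mulE scalerA mulVf ?(cochain2_neq0 psiP) // mulgK scale1r.
    over.
  rewrite sumr_const -[bas k g *+ _]scaler_nat scalerA card_sub mulVf ?scale1r //.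
  exact: card_neq0.
(* Here $\varphi = \varepsilon(\delta_e) = |L|$, nonzero in characteristic $0$. *)
exists #|L|%:R; first exact: card_neq0.
apply/lfunP=> c; rewrite comp_lfunE scale_lfunE id_lfunE tga_unitE linearZ /=.
by rewrite tga_counitE eqxx mul1r -[LHS]/(_ * _) -[RHS]/(_ * _) mulrC.
Qed.

End TwistedGroupAlgebra.

Theorem proposition5p9
  (k : closedFieldType) (char0 : [pchar k] =i pred0)
  (gT : finGroupType)
  (omega : gT -> gT -> gT -> k) (omegaP : normalized_3cocycle omega)
  (L : {group gT}) (omegaL : trivial_class (restrict3 L omega))
  (psi : [subg L] -> [subg L] -> k) (psiP : normalized_2cochain psi)
  (dpsi : has_coboundary psi (restrict3 L omega)) :
  let A := twisted_group_algebra char0 omegaP psiP dpsi in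
  [/\ connected A, indecomposable A, special A & separable A].
Proof.
move=> A; split.
- exact: tga_connected.
- exact/(connected_indecomposable (cocycle3_neq0 omegaP))/tga_connected.
- exact: tga_special.
- exact/special_separable/tga_special.
Qed.
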